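(* Let $(\mathfrak g,[-,-],(-)^{[p]})$ be a restricted Lie algebra over $\mathbf k$ and let $\lambda\in\mathbf k$. A linear operator $R:\mathfrak g\to\mathfrak g$ is a restricted Rota-Baxter operator of weight $\lambda$ on $\mathfrak g$ if and only if its graph $$G(\mathfrak g,R):=\{(x,R(x))\mid x\in\mathfrak g\}\subseteq\mathfrak g\oplus\mathfrak g$$ is a restricted Lie subalgebra (a Lie subalgebra closed under the $p$-map) of the semidirect product restricted Lie algebra $(\mathfrak g_\lambda\rtimes_{\mathrm{ad}}\mathfrak g,(-)^{[p]_\rtimes})$.
   Context: Convention: $\mathbf k$ is an algebraically closed field of prime characteristic $p$; everything is over $\mathbf k$. Restricted Lie algebra: a Lie algebra $(\mathfrak g,[-,-])$ with a $p$-map $(-)^{[p]}:\mathfrak g\to\mathfrak g$ satisfying $(ax)^{[p]}=a^px^{[p]}$ for $a\in\mathbf k$, $[x^{[p]},y]=(\mathrm{ad}_x)^p(y)$, and $(x+y)^{[p]}=x^{[p]}+y^{[p]}+\sum_{i=1}^{p-1}s_i(x,y)$, where $i\,s_i(x,y)$ is the coefficient of $t^{i-1}$ in $(\mathrm{ad}_{tx+y})^{p-1}(x)\in\mathbf k[t]\otimes\mathfrak g$. Rota-Baxter operator of weight $\lambda$ on a Lie algebra $\mathfrak g$: a linear map $R:\mathfrak g\to\mathfrak g$ with $[R(x),R(y)]=R([R(x),y])+R([x,R(y)])+\lambda R([x,y])$ for all $x,y$. Put $x\rhd_Ry:=[R(x),y]$ and $x^{\rhd_Rk}:=x\rhd_R(x\rhd_R\cdots(x\rhd_Rx)\cdots)$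 ($k$ copies of $x$, $x^{\rhd_R1}=x$). For a composition $\alpha=(\alpha_1,\dots,\alpha_r)\vDash n$ (a tuple of positive integers with sum $n$, of length $\ell(\alpha)=r$), $C_\alpha=\prod_{k=1}^r\binom{\alpha_1+\cdots+\alpha_k-1}{\alpha_k-1}$. On a restricted Lie algebra $(\mathfrak g,[-,-],(-)^{[p]})$, a Rota-Baxter operator $R$ of weight $\lambda$ is called restricted if $R(x^{[p]_R})=R(x)^{[p]}$ for all $x\in\mathfrak g$, where $$x^{[p]_R}:=\lambda^{p-1}x^{[p]}+\sum_{r=1}^{p-1}\frac1r\lambda^{r-1}\sum_{\alpha\vDash p,\ \ell(\alpha)=r}C_\alpha\,[x^{\rhd_R\alpha_1},[x^{\rhd_R\alpha_2},[\cdots[x^{\rhd_R\alpha_{r-1}},x^{\rhd_R\alpha_r}]\cdots]]]$$ ($\lambda^0=1$; $\frac1r$ is the inverse of $r$ modulo $p$). $\mathfrak g_\lambda$ denotes the restricted Lie algebra with underlying space $\mathfrak g$, bracket $[x,y]_\lambda:=\lambda[x,y]$ and $p$-map $x^{[p]_\lambda}:=\lambda^{p-1}x^{[p]}$. The semidirect product $\mathfrak g_\lambda\rtimes_{\mathrm{ad}}\mathfrak g$ is $\mathfrak g\oplus\mathfrak g$ with bracket $[(x,a),(y,b)]_\rtimes=(\lambda[x,y]+[a,y]-[b,x],\,[a,b])$ and $p$-map $$(x,y)^{[p]_\rtimes}:=\Big(\lambda^{p-1}x^{[p]}+\sum_{i=1}^{p-1}\lambda^{i-1}s_i(x,y),\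 y^{[p]}\Big),$$ where $s_i(x,y)\in\mathfrak g$ is computed with the original bracket $[-,-]$ of $\mathfrak g$, i.e. $i\,s_i(x,y)$ is the coefficient of $t^{i-1}$ in $(\mathrm{ad}_{tx+y})^{p-1}(x)\in\mathbf k[t]\otimes\mathfrak g$ with $\mathrm{ad}_u(v)=[u,v]$. *)

(* Defs.v *)
From HB Require Import structures.
From mathcomp Require Import all_boot all_order all_algebra.

Set Implicit Arguments.
Unset Strict Implicit.
Unset Printing Implicit Defensive.

Import GRing.Theory.
Local Open Scope ring_scope.

Section RestrictedLie.

Variables (k : fieldType) (p : nat).

Section Operations.

Variables (g : lmodType k) (br : g -> g -> g) (pm : g -> g).

Record lie_axioms : Prop := LieAxioms {
  lie_linearl : forall (a : k) (x y z : g),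
    br (a *: x + y) z = a *: br x z + br y z;
  lie_linearr : forall (a : k) (x y z : g),
    br z (a *: x + y) = a *: br z x + br z y;
  lie_alternating : forall x : g, br x x = 0;
  lie_jacobi : forall x y z : g,
    br x (br y z) + br y (br z x) + br z (br x y) = 0
}.

(* An element of k[t] (x) g is given by its sequence of coefficients          *)
(* nat -> g; all the sequences obtained below have finite support. The        *)
(* bracket [gpoly_br] is the k[t]-bilinear extension of the one of g.         *)
Definition gpoly_br (f h : nat -> g) : nat -> g :=
  fun n => \sum_(i < n.+1) br (f i) (h (n - i)%N).

Definition gpolyC (x : g) : nat -> g := fun n => if n is 0 then x else 0.

(* t x + y *)
Definition gpoly_lin (x y : g) : nat -> g :=
  fun n => match n with 0 => y | 1 => x | _ => 0 end.

Definition lie_s (i : nat) (x y : g) : g :=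
  (i%:R : k)^-1 *: iter p.-1 (gpoly_br (gpoly_lin x y)) (gpolyC x) i.-1.

Record restricted_lie_axioms : Prop := RestrictedLieAxioms {
  restricted_lie_lie : lie_axioms;
  pmapZ : forall (a : k) (x : g), pm (a *: x) = a ^+ p *: pm x;
  pmap_ad : forall x y : g, br (pm x) y = iter p (br x) y;
  pmapD : forall x y : g,
    pm (x + y) = pm x + pm y + \sum_(1 <= i < p) lie_s i x y
}.

Record restricted_lie_subalgebra (S : g -> Prop) : Prop :=
  RestrictedLieSubalgebra {
    subalg0 : S 0;
    subalgD : forall x y : g, S x -> S y -> S (x + y);
    subalgZ : forall (a : k) (x : g), S x -> S (a *: x);
    subalg_br : forall x y : g, S x -> S y -> S (br x y);
    subalg_pmap : forall x : g, S x -> S (pm x)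
  }.

(* [:: x_1; ...; x_r] |-> [x_1, [x_2, ... [x_(r-1), x_r] ...]];               *)
(* only used for r > 0                                                        *)
Fixpoint nested_br (s : seq g) : g :=
  match s with
  | [::] => 0
  | [:: x] => x
  | x :: s' => br x (nested_br s')
  end.

Definition rota_baxter (lam : k) (R : {linear g -> g}) : Prop :=
  forall x y : g,
    br (R x) (R y) = R (br (R x) y) + R (br x (R y)) + lam *: R (br x y).

Definition rb_op (R : g -> g) (x y : g) : g := br (R x) y.

(* n copies of x, n > 0 *)
Definition rb_pow (R : g -> g) (x : g) (n : nat) : g :=
  iter n.-1 (rb_op R x) x.

End Operations.

Definition is_composition (n : nat) (s : seq nat) : bool :=
  all (leq 1) s && (sumn s == n).

Definition comp_coef (s : seq nat) : nat :=
  (\prod_(i < size s) 'C((sumn (take i.+1 s)).-1, (nth 0 s i).-1))%N.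

Section RotaBaxter.

Variables (g : lmodType k) (br : g -> g -> g) (pm : g -> g).
Variable lam : k.

(* The parts of a composition of p are at most p, so the compositions of p of *)
(* length r are to be found among the r-tuples with entries in 'I_p.+1.       *)
Definition rb_pmap (R : g -> g) (x : g) : g :=
  lam ^+ p.-1 *: pm x +
  \sum_(1 <= r < p) ((r%:R)^-1 * lam ^+ r.-1) *:
    \sum_(al : r.-tuple 'I_p.+1 | is_composition p (map val al))
      (comp_coef (map val al))%:R *:
        nested_br br [seq rb_pow br R x (val n) | n <- al].

Definition restricted_rota_baxter (R : {linear g -> g}) : Prop :=
  rota_baxter br lam R /\ forall x : g, R (rb_pmap R x) = pm (R x).

Definition semidirect_br (u v : g * g) : g * g :=
  (lam *: br u.1 v.1 + br u.2 v.1 - br v.2 u.1, br u.2 v.2).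

Definition semidirect_pmap (u : g * g) : g * g :=
  (lam ^+ p.-1 *: pm u.1 +
     \sum_(1 <= i < p) lam ^+ i.-1 *: lie_s br i u.1 u.2,
   pm u.2).

Definition rb_graph (R : g -> g) : g * g -> Prop :=
  fun u => exists x : g, u = (x, R x).

End RotaBaxter.

End RestrictedLie.

(* Main.v *)
Require Import Defs.
From HB Require Import structures.
From mathcomp Require Import all_boot all_order all_algebra.

Import GRing.Theory.
Local Open Scope ring_scope.

(** The two [p]-maps agree on the graph: for all [x] and [y], the coefficient
    of [t^r] in [(ad_(tx+y))^n x] is the sum of [C_al [x_al1, [..., x_al(r+1)]]]
    over the compositions [al] of [n+1] of length [r+1], where
    [x_a = ad_y^(a-1) x]. As [ad_y] is a derivation, this amounts to a
    recurrence for [C_al] when [n] grows. To prove it by peeling off the first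
    part of [al], one replaces [C_al] by
    [prod_k 'C(b + al_1 + ... + al_k - 1, al_k - 1)] for an offset [b].
    Combinatorially, this counts the set partitions with blocks of sizes
    [b, al_1, al_2, ...] ordered by their maxima, and the recurrence removes the
    smallest element of the underlying set. *)

Definition comp_coef_from (b : nat) (s : seq nat) : nat :=
  (\prod_(i < size s) 'C((b + sumn (take i.+1 s)).-1, (nth 0 s i).-1))%N.

Lemma comp_coef_from0 (s : seq nat) : comp_coef_from 0 s = comp_coef s.
Proof. by []. Qed.

Lemma comp_coef_from_cons (b a : nat) (s : seq nat) :
  comp_coef_from b (a :: s) =
  ('C((b + a).-1, a.-1) * comp_coef_from (b + a) s)%N.
Proof.
rewrite /comp_coef_from /= big_ord_recl /= take0 /= addn0; congr (_ * _)%N.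
by apply: eq_bigr => i _; rewrite /= addnA.
Qed.

Lemma is_composition_cons (n a : nat) (s : seq nat) :
  is_composition n (a :: s) =
  [&& (0 < a)%N, (a <= n)%N & is_composition (n - a) s].
Proof.
rewrite /is_composition /= -!andbA; congr (_ && _).
case: (leqP a n) => [le_an | lt_na] /=.
  by rewrite -(eqn_add2l a (sumn s)) subnKC.
by rewrite [X in _ && X]gtn_eqF ?andbF // ltn_addr.
Qed.

Lemma big_tuple_cons (V : nmodType) (T : finType) (r : nat)
    (P : pred (r.+1.-tuple T)) (F : r.+1.-tuple T -> V) :
  \sum_(t | P t) F t =
  \sum_(a : T) \sum_(t : r.-tuple T | P (cons_tuple a t)) F (cons_tuple a t).
Proof.
rewrite pair_big_dep /=.
rewrite (reindex (fun u : T * r.-tuple T => cons_tuple u.1 u.2)) //=.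
exists (fun t => (thead t, behead_tuple t)) => [[a t] _ | t _] /=.
  by congr pair; apply: val_inj.
by apply: val_inj; rewrite /= [in RHS](tuple_eta t).
Qed.

Section LieExpansion.

Variables (k : fieldType) (g : lmodType k) (br : g -> g -> g).
Hypothesis hbr : lie_axioms br.

Lemma lie_br0r (x : g) : br x 0 = 0.
Proof.
have := lie_linearr hbr 1 0 0 x; rewrite !scale1r addr0 => /eqP.
by rewrite -subr_eq subrr eq_sym => /eqP.
Qed.

Lemma lie_brDr (z x y : g) : br z (x + y) = br z x + br z y.
Proof. by have := lie_linearr hbr 1 x y z; rewrite !scale1r. Qed.

Lemma lie_brDl (z x y : g) : br (x + y) z = br x z + br y z.
Proof. by have := lie_linearl hbr 1 x y z; rewrite !scale1r. Qed.

Lemma lie_br0l (x : g) : br 0 x = 0.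
Proof.
have := lie_brDl x 0 0; rewrite addr0 => /eqP.
by rewrite -subr_eq subrr eq_sym => /eqP.
Qed.

Lemma lie_br_sumr (I : Type) (s : seq I) (P : pred I) (F : I -> g) (x : g) :
  br x (\sum_(i <- s | P i) F i) = \sum_(i <- s | P i) br x (F i).
Proof. exact: (big_morph (br x) (lie_brDr x) (lie_br0r x)). Qed.

Lemma lie_brMnr (x y : g) (n : nat) : br x (y *+ n) = br x y *+ n.
Proof.
by elim: n => [|n IHn]; rewrite ?mulr0n ?lie_br0r // !mulrS lie_brDr IHn.
Qed.

Lemma lie_brC (x y : g) : br x y = - br y x.
Proof.
have := lie_alternating hbr (x + y).
rewrite lie_brDl !lie_brDr !(lie_alternating hbr) add0r addr0.
by move/eqP; rewrite addr_eq0 => /eqP.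
Qed.

Lemma lie_brNr (x y : g) : br x (- y) = - br x y.
Proof. by apply/eqP; rewrite -addr_eq0 -lie_brDr addNr lie_br0r. Qed.

Lemma lie_leibniz (y u v : g) : br y (br u v) = br (br y u) v + br u (br y v).
Proof.
have := lie_jacobi hbr y u v.
rewrite (lie_brC v y) lie_brNr (lie_brC v (br y u)) => /eqP.
by rewrite subr_eq0 subr_eq => /eqP.
Qed.

Section Expansion.

Variables x y : g.

Let ady_pow (i : nat) : g := iter i (br y) x.

Lemma ady_powS (i : nat) : br y (ady_pow i) = ady_pow i.+1.
Proof. by []. Qed.

(* The sum of [comp_coef_from b al] times the nested bracket of the
   [ad_y^(al_k - 1) x], over the compositions [al] of [n] of length [r.+1]. *)
Fixpoint comp_sum (r b n : nat) : g :=
  match r with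
  | 0 => if n is m.+1 then ady_pow m *+ 'C(b + m, m) else 0
  | r'.+1 => \sum_(i < n)
      br (ady_pow i) (comp_sum r' (b + i).+1 (n - i.+1)%N) *+ 'C(b + i, i)
  end.

Lemma comp_sum0 (r b : nat) : comp_sum r b 0 = 0.
Proof. by case: r => //= r; rewrite big_ord0. Qed.

(** Common source of the recurrences for positive and for zero offset, which differ only in what the
    last sum becomes. The hypothesis is [comp_sumSS] for compositions one part shorter. *)
Lemma comp_sum_step (r b n : nat) :
    (forall c m, comp_sum r c.+1 m.+1 =
       comp_sum r c m.+1 + br y (comp_sum r c.+1 m)) ->
  comp_sum r.+1 b n.+1 = br y (comp_sum r.+1 b n) +
    \sum_(i < n.+1)
      br (ady_pow i) (comp_sum r (b + i) (n - i)%N) *+ 'C((b + i).-1, i).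
Proof.
move=> IHr /=; rewrite lie_br_sumr.
have brE (i : nat) (z : g) c : br y (br (ady_pow i) z *+ c) =
    br (ady_pow i.+1) z *+ c + br (ady_pow i) (br y z) *+ c.
  by rewrite lie_brMnr lie_leibniz mulrnDl.
(* The first part [n.+1] leaves nothing for the others. Once it is dropped, every inner sum has
   positive size and the hypothesis applies. *)
rewrite big_ord_recr /= subnn comp_sum0 lie_br0r mul0rn addr0.
under eq_bigr => i _.
  have -> : (n.+1 - i.+1 = (n - i.+1).+1)%N by rewrite subSS subnSK.
  rewrite IHr lie_brDr mulrnDl subnSK //.
  over.
rewrite [X in _ = X + _](eq_bigr _ (fun i _ => brE _ _ _)).
(* The terms in which [br y] acts on the inner sum agree on both sides. *)
rewrite !big_split /= addrAC; congr (_ + _).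
(* Pascal's rule in the sum with one more term, which vanishes *)
have -> : \sum_(i < n)
    br (ady_pow i) (comp_sum r (b + i) (n - i)%N) *+ 'C(b + i, i) =
  \sum_(i < n.+1)
    br (ady_pow i) (comp_sum r (b + i) (n - i)%N) *+ 'C(b + i, i).
  by rewrite big_ord_recr /= subnn comp_sum0 lie_br0r mul0rn addr0.
rewrite big_ord_recl [X in _ = _ + X]big_ord_recl /= !bin0 addrCA.
congr (_ + _); rewrite -big_split /=; apply: eq_bigr => i _.
by rewrite /bump /= add1n !addnS /= binS mulrnDr addrC.
Qed.

(** The smallest element lies in the offset block, whose size drops to [b], or in another block. The
    latter is not a singleton, which would precede the offset block; [br y] restores its lost
    element. *)
Lemma comp_sumSS (r b n : nat) :
  comp_sum r b.+1 n.+1 = comp_sum r b n.+1 + br y (comp_sum r b.+1 n).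
Proof.
elim: r b n => [|r IHr] b n; last first.
  (* At offset [b.+1] the predecessor in the binomial disappears, and the last sum is
     [comp_sum r.+1 b n.+1] by definition. *)
  by rewrite comp_sum_step // addrC; congr (_ + _).
case: n => [|n] /=; first by rewrite !addn0 !bin0 lie_br0r addr0.
rewrite lie_brMnr ady_powS -mulrnDr; congr (_ *+ _).
by rewrite addSn binS addSnnS.
Qed.

Lemma comp_sum00 (n : nat) : comp_sum 0 0 n.+1 = ady_pow n.
Proof. by rewrite /= add0n binn. Qed.

(** Without an offset block, the smallest element may also form the first block alone, whence the
    term in [br x]. *)
Lemma comp_sumS0S (r n : nat) :
  comp_sum r.+1 0 n.+1 = br y (comp_sum r.+1 0 n) + br x (comp_sum r 0 n).
Proof.
rewrite comp_sum_step; last exact: comp_sumSS.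
(* At offset 0 the binomial is ['C(i.-1, i)]: it is 1 for [i = 0] and 0 otherwise. *)
congr (_ + _); rewrite big_ord_recl /= big1 ?addr0 ?subn0 // => i _.
by rewrite /bump /= add1n bin_small.
Qed.

Lemma gpoly_br_lin0 (f : nat -> g) :
  gpoly_br br (gpoly_lin x y) f 0 = br y (f 0).
Proof. by rewrite /gpoly_br big_ord_recl big_ord0 addr0. Qed.

Lemma gpoly_br_linS (f : nat -> g) (n : nat) :
  gpoly_br br (gpoly_lin x y) f n.+1 = br y (f n.+1) + br x (f n).
Proof.
rewrite /gpoly_br !big_ord_recl /= subn0 subSS subn0 big1 ?addr0 // => i _.
by rewrite lie_br0l.
Qed.

(** Bracketing with [t x + y] acts on coefficients by the recurrence [comp_sumS0S]. *)
Lemma gpoly_iter_lin (n r : nat) :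
  iter n (gpoly_br br (gpoly_lin x y)) (gpolyC x) r = comp_sum r 0 n.+1.
Proof.
elim: n r => [|n IHn] [|r].
- by rewrite comp_sum00.
- by rewrite comp_sumS0S !comp_sum0 !lie_br0r addr0.
- by rewrite iterS gpoly_br_lin0 IHn !comp_sum00.
- by rewrite iterS gpoly_br_linS !IHn -comp_sumS0S.
Qed.

Lemma nested_br_cons (u : g) (s : seq g) :
  (0 < size s)%N -> nested_br br (u :: s) = br u (nested_br br s).
Proof. by case: s. Qed.

(** The bound [m] on the parts is separate from [n], so that the type of tuples stays fixed when the
    induction removes the first part. *)
Lemma comp_sumE (m r b n : nat) : (n <= m)%N ->
  \sum_(al : r.+1.-tuple 'I_m.+1 | is_composition n (map val al))
    nested_br br [seq ady_pow (val a).-1 | a <- al]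
      *+ comp_coef_from b (map val al) =
  comp_sum r b n.
Proof.
elim: r b n => [|r IHr] b n le_nm.
  rewrite big_tuple_cons /=.
  under eq_bigr => a _.
    rewrite (eq_bigl (fun t => (0 < a)%N && (a == n :> nat))); last first.
      by move=> t; rewrite tuple0 /is_composition /= addn0 andbT.
    rewrite big_mkcond /= (big_pred1 [tuple]); last first.
      by move=> t; rewrite /= [t]tuple0; apply/esym/eqP/val_inj.
    rewrite /= comp_coef_from_cons /comp_coef_from big_ord0 muln1.
    over.
  rewrite -big_mkcond /=.
  case: n le_nm => [|n] le_nm.
    by rewrite big_pred0 // => a; rewrite lt0n andNb.
  rewrite (big_pred1 (Ordinal (le_nm : (n.+1 < m.+1)%N))) /=.
    by rewrite addnS.
  move=> a; rewrite /= -val_eqE /=.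
  by case: eqP => [->|]; rewrite ?andbF.
rewrite big_tuple_cons.
have nested a (t : r.+1.-tuple 'I_m.+1) :
    nested_br br [seq ady_pow (val a).-1 | a <- cons_tuple a t] =
    br (ady_pow a.-1) (nested_br br [seq ady_pow (val a).-1 | a <- t]).
  by rewrite [map _ _]/= nested_br_cons // size_map size_tuple.
(* Extended by zero, the sum over the first part [a] loses [a = 0] and matches the sum over
   [i = a.-1] in [comp_sum], widened from [n] to [m]. *)
pose F (a : nat) := if (0 < a <= n)%N
  then br (ady_pow a.-1) (comp_sum r (b + a) (n - a)) *+ 'C((b + a).-1, a.-1)
  else 0.
rewrite (eq_bigr (fun a : 'I_m.+1 => F a)); last first.
  move=> a _; rewrite /F.
  under eq_bigl => t do rewrite /= is_composition_cons andbA.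
  case: ifP => [/andP[a_gt0 le_an] | _]; last by rewrite big_pred0.
  rewrite -IHr ?(leq_trans (leq_subr _ _)) // lie_br_sumr -sumrMnl.
  apply: eq_bigr => t _.
  by rewrite nested [map _ _]/= comp_coef_from_cons lie_brMnr -mulrnA mulnC.
rewrite big_ord_recl add0r /= (big_ord_widen m (fun i =>
  br (ady_pow i) (comp_sum r (b + i).+1 (n - i.+1)) *+ 'C(b + i, i))) //.
rewrite [RHS]big_mkcond; apply: eq_bigr => i _.
by rewrite /F /bump /= add1n addnS.
Qed.

End Expansion.

Lemma rb_pmapE (p : nat) (pm : g -> g) (lam : k) (R : g -> g) (x : g) :
    (0 < p)%N ->
  rb_pmap p br pm lam R x =
  lam ^+ p.-1 *: pm x +
    \sum_(1 <= i < p) lam ^+ i.-1 *: lie_s p br i x (R x).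
Proof.
(* Compositions of length [r.+1] give the coefficient of [t^r]; the factor [1/(r+1)] is the one in
   [lie_s]. *)
move=> p_gt0; congr (_ + _); apply: eq_big_nat => -[//|r] _ /=.
rewrite /lie_s gpoly_iter_lin prednK // -(comp_sumE x (R x) p) // scalerA.
rewrite mulrC; congr (_ *: _); apply: eq_bigr => al _.
by rewrite scaler_nat comp_coef_from0.
Qed.

End LieExpansion.

Theorem theorem4p7 (k : closedFieldType) (p : nat) (hp : p \in [pchar k])
    (g : lmodType k) (br : g -> g -> g) (pm : g -> g)
    (hg : restricted_lie_axioms p br pm) (lam : k) (R : {linear g -> g}) :
  restricted_rota_baxter p br pm lam R <->
  restricted_lie_subalgebra (semidirect_br br lam)
    (semidirect_pmap p br pm lam) (rb_graph R).
Proof.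
have p_gt0 : (0 < p)%N by apply: prime_gt0; case/andP: hp.
have hbr := restricted_lie_lie hg.
have brE x y : semidirect_br br lam (x, R x) (y, R y) =
    (lam *: br x y + br (R x) y + br x (R y), br (R x) (R y)).
  by rewrite /semidirect_br /= (lie_brC _ _ _ hbr x (R y)).
have pmE x : semidirect_pmap p br pm lam (x, R x) =
    (rb_pmap p br pm lam R x, pm (R x)).
  by rewrite /semidirect_pmap /= (rb_pmapE _ _ _ hbr).
(* A pair is in the graph exactly when [R] sends its first component to its second; for the pairs in
   [brE] and [pmE] these are the two defining identities. *)
split=> [[RB RBp] | [_ _ _ subbr subpm]].
  split.
  - by exists 0; rewrite linear0.
  - by move=> _ _ [x ->] [y ->]; exists (x + y); rewrite linearD.
  - by move=> a _ [x ->]; exists (a *: x); rewrite linearZ.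
  - move=> _ _ [x ->] [y ->]; rewrite brE RB; eexists; congr pair.
    by rewrite !linearD linearZ /= addrC addrA.
  - by move=> _ [x ->]; rewrite pmE -RBp; eexists.
split=> [x y | x].
  have [||z] := subbr (x, R x) (y, R y); [by exists x | by exists y |].
  rewrite brE => -[<- ->].
  by rewrite !linearD linearZ -addrA addrC.
have [|z] := subpm (x, R x); first by exists x.
by rewrite pmE => -[<- ->].
Qed.
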